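(* Let $\mathcal{H}$ be a real Hilbert space, let $\alpha\in\,]0,+\infty[$, let $A\colon\mathcal{H}\to 2^{\mathcal{H}}$ be maximally monotone, and let $B\colon\mathcal{H}\to\mathcal{H}$ be $\alpha$-cocoercive. Let $\varepsilon\in\,]0,\min\{1/2,2\alpha\}[$, let $(\gamma_n)_{n\in\mathbb{N}}$ be a sequence in $[\varepsilon,2\alpha]$, and let $(\mu_n)_{n\in\mathbb{N}}$ satisfy $$(\forall n\in\mathbb{N})\quad\varepsilon\leq\mu_n\leq\frac{4\alpha-\gamma_n}{4\alpha}.$$ Suppose that the set $Z=\{x\in\mathcal{H}\mid 0\in Ax+Bx\}$ is not empty and let $Z^*=\{x^*\in\mathcal{H}\mid 0\in-A^{-1}(-x^* )+B^{-1}x^*\}$. Let $x_0\in\mathcal{H}$ and iterate, for every $n\in\mathbb{N}$, $$b_n^*=\gamma_nBx_n,\quad w_n=J_{\gamma_nA}(x_n-b_n^* ),\quad x_{n+1}=\mathsf{Q}\bigl(x_0,x_n,x_n+\mu_n(w_n-x_n)\bigr).$$ Then the following hold: (i) $(x_n)_{n\in\mathbb{N}}$ converges strongly to $\mathrm{proj}_Zx_0$. (ii) $Z^*$ contains a single point $\overline{x}^*$ and $(Bx_n)_{n\in\mathbb{N}}$ converges strongly to $\overline{x}^*$.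
   Context: For $M\colon\mathcal{H}\to2^{\mathcal{H}}$, $M^{-1}$ is the set-valued inverse and $J_M=(\mathrm{Id}+M)^{-1}$ is the resolvent (single-valued and defined everywhere when $M$ is maximally monotone). $M$ is maximally monotone if it is monotone and no monotone operator has a graph strictly containing that of $M$. $B$ is $\alpha$-cocoercive if $\langle x-y\mid Bx-By\rangle\ge\alpha\|Bx-By\|^2$ for all $x,y$. $\mathrm{proj}_D$ is the projection operator onto a nonempty closed convex set $D$. For $(x,y)\in\mathcal{H}^2$, $H(x,y)=\{z\in\mathcal{H}\mid\langle z-y\mid x-y\rangle\leq 0\}$; for $(x,y,z)\in\mathcal{H}^3$ such that $H(x,y)\cap H(y,z)\neq\varnothing$, $\mathsf{Q}(x,y,z)$ is the projection of $x$ onto $H(x,y)\cap H(y,z)$. *)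

(* Defs.v *)
From HB Require Import structures.
From mathcomp Require Import all_boot all_order all_algebra.
From mathcomp Require Import all_classical all_reals all_analysis.
Set Implicit Arguments.
Unset Strict Implicit.
Unset Printing Implicit Defensive.
Import Order.TTheory GRing.Theory Num.Theory.
Import numFieldNormedType.Exports.
Local Open Scope classical_set_scope.
Local Open Scope ring_scope.

(* A real Hilbert space is presented as a complete normed module [H] over a
   [realType] together with a positive definite symmetric form [ip] on [H] such
   that [ip x x = `|x| ^+ 2]. *)

Section SetValuedOperators.
Context {R : realType} {H : completeNormedModType R}.
Implicit Types (M N : H -> set H) (T : H -> H).

Definition op_graph M : set (H * H) := [set p | M p.1 p.2].

Definition op_inv M : H -> set H := fun u => [set x | M x u].

Definition op_add M N : H -> set H :=
  fun x => [set u + v | u in M x & v in N x].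

Definition op_opp M : H -> set H := fun x => [set - u | u in M x].

Definition op_scale (c : R) M : H -> set H := fun x => [set c *: u | u in M x].

Definition op_of T : H -> set H := fun x => [set T x].

(* The resolvent as a point-valued map. The set below is a singleton when [M] is
   maximally monotone; the default value [0] is used only if it is empty. *)
Definition resolvent M : H -> H :=
  fun x => xget 0 (op_inv (op_add (op_of idfun) M) x).

Definition primal_sol A B : set H := [set x | op_add A (op_of B) x 0].

Definition dual_sol A B : set H :=
  [set y | op_add (op_opp (op_inv A \o -%R)) (op_inv (op_of B)) y 0].

(* The projection exists and is unique when [D] is nonempty, closed and convex;
   the default value [0] is used only if there is no nearest point. *)
Definition metric_proj (D : set H) (x : H) : H :=
  xget 0 [set p | D p /\ forall q, D q -> `|x - p| <= `|x - q|].

End SetValuedOperators.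

Section InnerProduct.
Context {R : realType} {H : completeNormedModType R}.
Variable ip : {dot H for idfun}.

Definition monotone_op (M : H -> set H) : Prop :=
  forall x y u v, M x u -> M y v -> 0 <= ip (x - y) (u - v).

Definition maximally_monotone (M : H -> set H) : Prop :=
  monotone_op M /\ ~ exists N, monotone_op N /\ op_graph M `<` op_graph N.

Definition cocoercive (alpha : R) (B : H -> H) : Prop :=
  forall x y, alpha * `|B x - B y| ^+ 2 <= ip (x - y) (B x - B y).

Definition halfspace (x y : H) : set H := [set z | ip (z - y) (x - y) <= 0].

Definition haugazeau (x y z : H) : H :=
  metric_proj (halfspace x y `&` halfspace y z) x.

End InnerProduct.

(* Main.v *)
(* Each x_(n+1) is the projection of x_0 onto an intersection of two half-spaces
   containing Z, so |x_n - x_0| increases and is bounded by the distance from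
   x_0 to p = proj_Z x_0. Summing the squared steps gives w_n - x_n -> 0, and
   then testing monotonicity against a graph point (a, v) of A yields
   limsup <x_n - a | v + B a> <= 0. As Z consists of the y with
   <y - a | v + B a> <= 0 for every (a, v) in the graph of A, it is closed and
   convex and contains the weak cluster points of (x_n). Strong convergence
   follows from |x_n - p|^2 <= 2 <x_n - p | x_0 - p>.

   Projections, weak cluster points (as asymptotic centers) and the surjectivity
   of Id + g A (through the Fitzpatrick function of A) are all obtained by
   minimizing a strongly convex function. *)

Require Import Defs.
From HB Require Import structures.
From mathcomp Require Import all_boot all_order all_algebra.
From mathcomp Require Import all_classical all_reals all_analysis ring lra.
Set Implicit Arguments.
Unset Strict Implicit.
Unset Printing Implicit Defensive.
Import Order.TTheory GRing.Theory Num.Theory.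
Import numFieldNormedType.Exports.
Local Open Scope classical_set_scope.
Local Open Scope ring_scope.

(** * Real inequalities, Cauchy sequences and strongly convex minimization *)

(** First-order optimality: turns minimality along a segment into a variational inequality. *)
Lemma ge0_of_small_quadratic (R : realFieldType) (a b : R) :
  (forall t, 0 < t <= 1 -> 0 <= t * a + t ^+ 2 * b) -> 0 <= a.
Proof.
move=> ab; rewrite leNgt; apply/negP => a0.
(* With this [t], [a + t * |b| = - t * (1 - a) < 0]. *)
pose t := - a / (`|b| - a + 1).
have b0 := normr_ge0 b; have bb := ler_norm b.
have c0 : 0 < `|b| - a + 1 by lra.
have t0 : 0 < t by rewrite divr_gt0//; lra.
have t1 : t <= 1 by rewrite ler_pdivrMr//; lra.
have tc : t * (`|b| - a + 1) = - a by rewrite divfK// gt_eqF.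
have := ab t; rewrite t0 t1 => /(_ isT).
have -> : t * a + t ^+ 2 * b = t * (a + t * b) by ring.
rewrite pmulr_rge0//.
have : t * b <= t * `|b| by rewrite ler_pM2l.
have : 0 < t * (1 - a) by rewrite mulr_gt0//; lra.
lra.
Qed.

Lemma harmonic_lt_near (R : realType) (e : R) : 0 < e ->
  \forall n \near \oo, n.+1%:R^-1 < e.
Proof.
by move=> e0; apply: (cvgr_lt _ (@cvg_harmonic R)).
Qed.

Lemma cvg_sqr_norm (R : realType) (V : normedModType R) (T : Type)
    (F : set_system T) (FF : Filter F) (f : T -> V) (l : V) :
  f @ F --> l -> `|f t| ^+ 2 @[t --> F] --> `|l| ^+ 2.
Proof.
move=> fl; rewrite expr2; under eq_cvg do rewrite expr2.
by apply: cvgM; exact: cvg_norm.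
Qed.

Lemma cvg_of_sq_dist (R : realType) (V : completeNormedModType R)
    (y : nat -> V) (e : nat -> R) :
  (forall n m, (n <= m)%N -> `|y n - y m| ^+ 2 <= e n) ->
  e @ \oo --> 0 -> exists l : V, y @ \oo --> l.
Proof.
move=> ye e0; suff /cvg_ex : cvgn y by [].
apply: cauchy_cvg; apply: cauchy_exP => d d0.
have : \forall n \near \oo, e n < d ^+ 2.
  by apply: (cvgr_lt _ e0); rewrite exprn_gt0.
move=> [N _ /(_ N (leqnn N)) /= eN].
exists (y N), N => // k /= Nk.
rewrite -ball_normE /ball_ /=.
rewrite -(@ltr_pXn2r _ 2)// ?nnegrE//; last exact: ltW.
exact: le_lt_trans (ye _ _ Nk) eN.
Qed.

(** The product carries the maximum norm, so each coordinate inherits the bound. Serves the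
    minimization over pairs in [minty]. *)
Lemma cvg_of_sq_dist_pair (R : realType) (V : completeNormedModType R)
    (y : nat -> V * V) (e : nat -> R) :
  (forall n m, (n <= m)%N -> `|y n - y m| ^+ 2 <= e n) ->
  e @ \oo --> 0 -> exists l : V * V, y @ \oo --> l.
Proof.
move=> ye e0.
have [l1 yl1] : exists l : V, (fun n => (y n).1) @ \oo --> l.
  apply: (@cvg_of_sq_dist _ _ _ e) => // n m /ye; apply: le_trans.
  rewrite lerXn2r ?nnegrE//.
  by rewrite [leRHS]prod_normE le_max lexx.
have [l2 yl2] : exists l : V, (fun n => (y n).2) @ \oo --> l.
  apply: (@cvg_of_sq_dist _ _ _ e) => // n m /ye; apply: le_trans.
  rewrite lerXn2r ?nnegrE//.
  by rewrite [leRHS]prod_normE le_max lexx orbT.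
exists (l1, l2); rewrite (_ : y = fun n => ((y n).1, (y n).2)).
  exact: cvg_pair yl1 yl2.
by apply/funext => n; case: (y n).
Qed.

(* [S a] plays the role of the sublevel set [{f <= a}] of a strongly convex
   lower semicontinuous function [f] with values in ]-oo, +oo]. *)
Lemma strongly_convex_min (R : realType) (V : normedModType R)
    (S : R -> set V) (c l : R) :
  (forall (y : nat -> V) (e : nat -> R),
    (forall n m, (n <= m)%N -> `|y n - y m| ^+ 2 <= e n) ->
    e @ \oo --> 0 -> exists l : V, y @ \oo --> l) ->
  0 < c ->
  (forall a b, a <= b -> S a `<=` S b) ->
  (forall a b p q, S a p -> S b q ->
    S ((a + b) / 2 - c * `|p - q| ^+ 2) (p + 2^-1 *: (q - p))) ->
  (forall a (y : nat -> V) p, y @ \oo --> p ->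
    (forall n, S (a + n.+1%:R^-1) (y n)) -> S a p) ->
  (forall a p, S a p -> l <= a) ->
  (exists a p, S a p) ->
  exists m p, S m p /\ forall a q, S a q -> m <= a.
Proof.
move=> Vcomplete c0 Sle Smid Scl Sl [a1 [p1 Sap1]].
pose T := [set a | S a !=set0].
have Tinf : has_inf T.
  by split; [exists a1, p1 | exists l => a [p /Sl]].
have mT a q : S a q -> inf T <= a.
  by move=> Saq; apply: ge_inf; [exact: Tinf.2 | exists q].
have /choice[y yS] : forall n : nat, exists p, S (inf T + n.+1%:R^-1) p.
  move=> n; have n0 : 0 < n.+1%:R^-1 :> R by rewrite invr_gt0.
  have [a [p Sap] an] := inf_adherent n0 Tinf.
  by exists p; apply: Sle Sap; exact: ltW.
have [p yp] : exists p : V, y @ \oo --> p.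
  (* The midpoint of [y n] and [y k] has value at least [inf T], so [c * |y n - y k|^2] is at most
     the mean of the two excesses, hence at most the larger one. *)
  apply: (Vcomplete y (fun n => c^-1 * n.+1%:R^-1)); last first.
    rewrite -(mulr0 c^-1); apply: cvgMr; exact: cvg_harmonic.
  move=> n k nk; rewrite ler_pdivlMl//.
  have := mT _ _ (Smid _ _ _ _ (yS n) (yS k)).
  have : k.+1%:R^-1 <= n.+1%:R^-1 :> R by rewrite lef_pV2 ?posrE// ler_nat.
  move: (n.+1%:R^-1) (k.+1%:R^-1) (inf T) (c * _) => a b i d; lra.
by exists (inf T), p; split=> //; exact: Scl yp yS.
Qed.

(** * Inner product calculus *)

Section HilbertSpace.
Context (R : realType) (H : completeNormedModType R) (ip : {dot H for idfun}).
Context (ip_norm : forall x : H, ip x x = `|x| ^+ 2).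
Implicit Types (x y z p q u v : H) (D : set H) (b c t : R).

Lemma ipC x y : ip x y = ip y x.
Proof. by rewrite (hermC ip x y) mul1r. Qed.

Lemma ipDl x y z : ip (x + y) z = ip x z + ip y z.
Proof. by rewrite linearDl. Qed.

Lemma ipDr x y z : ip x (y + z) = ip x y + ip x z.
Proof. by rewrite linearDr. Qed.

Lemma ipNl x z : ip (- x) z = - ip x z.
Proof. by rewrite linearNl. Qed.

Lemma ipNr x z : ip x (- z) = - ip x z.
Proof. by rewrite linearNr. Qed.

Lemma ipZl t x z : ip (t *: x) z = t * ip x z.
Proof. by rewrite linearZl_LR. Qed.

Lemma ipZr t x z : ip x (t *: z) = t * ip x z.
Proof. by rewrite linearZr_LR. Qed.

Definition ipE := (ipDl, ipDr, ipNl, ipNr, ipZl, ipZr).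

Lemma ip_le_norm x y : ip x y <= `|x| * `|y|.
Proof.
have : `|x + y| ^+ 2 <= (`|x| + `|y|) ^+ 2.
  by rewrite lerXn2r ?nnegrE ?addr_ge0// ler_normD.
rewrite -ip_norm !ipE (ipC y x) sqrrD -!ip_norm.
lra.
Qed.

(** Polarization expresses the form through norms. *)
Lemma ip_continuous u : continuous (ip ^~ u).
Proof.
move=> x.
have -> : ip ^~ u = fun y => 4^-1 * (`|y + u| ^+ 2 - `|y - u| ^+ 2).
  by apply/funext => y; rewrite -!ip_norm !ipE (ipC u y); field.
apply: cvgM; first exact: cvg_cst.
apply: cvgB; apply: cvg_sqr_norm.
- by apply: cvgD; [exact: cvg_id | exact: cvg_cst].
- by apply: cvgB; [exact: cvg_id | exact: cvg_cst].
Qed.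

Lemma closed_ip_le u c : closed [set z | ip z u <= c].
Proof.
apply: (@closed_comp _ _ (ip ^~ u) [set t | t <= c]); last exact: closed_le.
by move=> z _; exact: ip_continuous.
Qed.

Lemma sq_norm_segment x y t :
  `|x + t *: (y - x)| ^+ 2 =
  (1 - t) * `|x| ^+ 2 + t * `|y| ^+ 2 - t * (1 - t) * `|x - y| ^+ 2.
Proof. rewrite -!ip_norm !ipE (ipC y x); ring. Qed.

(** * Projections onto closed convex sets, and weak cluster points *)

Definition segment_closed D :=
  forall p q t, D p -> D q -> 0 <= t <= 1 -> D (p + t *: (q - p)).

Lemma halfspace_segment_closed x y : segment_closed (halfspace ip x y).
Proof.
move=> p q t; rewrite /halfspace /= => Dp Dq /andP[t0 t1].
have -> : ip (p + t *: (q - p) - y) (x - y) =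
  (1 - t) * ip (p - y) (x - y) + t * ip (q - y) (x - y).
  by rewrite !ipE; ring.
have : 0 <= (1 - t) * - ip (p - y) (x - y) by rewrite mulr_ge0; lra.
have : 0 <= t * - ip (q - y) (x - y) by rewrite mulr_ge0; lra.
lra.
Qed.

Lemma closed_halfspace x y : closed (halfspace ip x y).
Proof.
rewrite (_ : halfspace _ _ _ = [set z | ip z (x - y) <= ip y (x - y)]).
  exact: closed_ip_le.
by apply/seteqP; split => z; rewrite /halfspace /= ipDl ipNl subr_le0.
Qed.

(** By the parallelogram law the squared distance to [x] is strongly convex with constant [1/4], so
    a nearest point exists; moving it towards [q] gives the inequality. *)
Lemma metric_projP D x : D !=set0 -> closed D -> segment_closed D ->
  D (metric_proj D x) /\
  forall q, D q -> ip (q - metric_proj D x) (x - metric_proj D x) <= 0.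
Proof.
move=> [p0 Dp0] Dcl Dcvx.
have : exists m p, (D p /\ `|x - p| ^+ 2 <= m) /\
    forall a q, D q /\ `|x - q| ^+ 2 <= a -> m <= a.
  apply: (@strongly_convex_min R H
    (fun a p => D p /\ `|x - p| ^+ 2 <= a) 4^-1 0) => //.
  - exact: cvg_of_sq_dist.
  - by move=> a b ab p [Dp xp]; split => //; exact: le_trans xp ab.
  - move=> a b p q [Dp pa] [Dq qb]; split.
      by apply: Dcvx => //; apply/andP; split; lra.
    move: pa qb; rewrite -!ip_norm !ipE (ipC p x) (ipC q x) (ipC q p); lra.
  - move=> a y p yp yS; split.
      by apply: (closed_cvg D _ _ _ yp) => //; near=> n; exact: (yS n).1.
    apply/ler_addgt0Pr => e e0.
    apply: (@cvgr_to_le _ \oo _ _ (fun n => `|x - y n| ^+ 2)).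
      by apply: cvg_sqr_norm; apply: cvgB yp; exact: cvg_cst.
    near=> n; apply: le_trans (yS n).2 _; rewrite lerD2l ltW//.
    by near: n; exact: harmonic_lt_near.
  - by move=> a p [_]; apply: le_trans; rewrite sqr_ge0.
  - by exists (`|x - p0| ^+ 2), p0.
move=> [m [p1 [[Dp1 p1m] mmin]]].
(* Since a nearest point exists, [xget] does not return its default [0]. *)
have [Dp pmin] : [set p | D p /\ forall q, D q -> `|x - p| <= `|x - q|]
    (metric_proj D x).
  apply: xgetPex; exists p1; split=> // q Dq.
  rewrite -(@ler_pXn2r _ 2)// ?nnegrE//.
  exact: le_trans p1m (mmin _ _ (conj Dq (lexx _))).
split=> // q Dq.
set p := metric_proj D x in Dp pmin *.
suff : 0 <= - 2 * ip (q - p) (x - p) by lra.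
apply: (@ge0_of_small_quadratic _ _ (`|q - p| ^+ 2)) => t /andP[t0 t1].
have t01 : 0 <= t <= 1 by rewrite t1 ltW.
have := pmin _ (Dcvx _ _ _ Dp Dq t01).
rewrite -(@ler_pXn2r _ 2)// ?nnegrE// -!ip_norm.
rewrite opprD addrA ![ip (x - p - _) _]ipE (ipC _ (x - p)) !ipE.
rewrite (ipC x p) (ipC q p) (ipC x q); lra.
Unshelve. all: by end_near. Qed.

(* The minimizer of [p |-> limsup_k |s_k - p|^2] (the asymptotic center) does
   the job, so that no weak compactness argument is needed. *)
Lemma weak_cluster_point (s : nat -> H) (P : nat -> Prop) (b : R) :
  (forall k, `|s k| <= b) -> (forall N, exists k, (N <= k)%N /\ P k) ->
  exists y, forall u c N,
    (forall k, (N <= k)%N -> P k -> ip (s k) u <= c) -> ip y u <= c.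
Proof.
move=> sb Pinf.
pose S a p := forall b, a < b ->
  exists N, forall k, (N <= k)%N -> P k -> `|s k - p| ^+ 2 <= b.
have [m [p [Smp mmin]]] :
    exists m p, S m p /\ forall a q, S a q -> m <= a.
  apply: (@strongly_convex_min R H S 4^-1 0) => //.
  - exact: cvg_of_sq_dist.
  - by move=> a a' aa' p Sap d a'd; apply: Sap; exact: le_lt_trans a'd.
  - move=> a a' p q Sp Sq d.
    set e := d - ((a + a') / 2 - 4^-1 * `|p - q| ^+ 2) => de.
    have e0 : 0 < e by rewrite subr_gt0.
    have [|N1 pN1] := Sp (a + e); first by rewrite ltrDl.
    have [|N2 qN2] := Sq (a' + e); first by rewrite ltrDl.
    exists (maxn N1 N2) => k; rewrite geq_max => /andP[k1 k2] Pk.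
    have := pN1 k k1 Pk; have := qN2 k k2 Pk; rewrite /e.
    rewrite -!ip_norm !ipE (ipC p (s k)) (ipC q (s k)) (ipC q p); lra.
  - move=> a y p yp yS d ad.
    pose e := (d - a) / 3; pose b' := a + 2 * e.
    have e0 : 0 < e by rewrite divr_gt0 ?subr_gt0.
    have b'd : b' < d by rewrite /b' /e; lra.
    (* Majorant of [|s k - p|^2]: for [r = |s k - y n|] and [h = |y n - p|], expand [(r + h)^2] and
       use [2 h r <= h (r^2 + 1)] and [r^2 <= b']. *)
    pose f n := b' + `|y n - p| * (b' + 1) + `|y n - p| * `|y n - p|.
    have : f @ \oo --> b' + `|p - p| * (b' + 1) + `|p - p| * `|p - p|.
      have yp0 : `|y n - p| @[n --> \oo] --> `|p - p|.
        by apply: cvg_norm; apply: cvgB => //; exact: cvg_cst.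
      apply: cvgD; last exact: cvgM.
      by apply: cvgD; [exact: cvg_cst | apply: cvgM => //; exact: cvg_cst].
    rewrite subrr normr0 !mul0r !addr0 => fb'.
    have [n [fnd nlt]] : exists n, f n < d /\ n.+1%:R^-1 < e.
      apply: (@filter_ex _ \oo); apply: filterI; first exact: cvgr_lt fb' _ b'd.
      exact: harmonic_lt_near.
    have [|N HN] := yS n b'; first by rewrite ltrD2l (lt_trans nlt)//; lra.
    exists N => k Nk Pk; have := HN k Nk Pk.
    have : `|s k - p| ^+ 2 <= (`|s k - y n| + `|y n - p|) ^+ 2.
      rewrite lerXn2r ?nnegrE ?addr_ge0//.
      by rewrite (le_trans _ (ler_normD _ _))// addrA subrK.
    have : 0 <= `|y n - p| * (`|s k - y n| - 1) ^+ 2 by rewrite mulr_ge0 ?sqr_ge0.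
    move: fnd; rewrite /f => fnd h1 h2 h3.
    have : `|y n - p| * `|s k - y n| ^+ 2 <= `|y n - p| * b' by rewrite ler_wpM2l.
    lra.
  - move=> a p Sap; apply/ler_addgt0Pr => e e0.
    have [|N HN] := Sap (a + e); first by rewrite ltrDl.
    have [k [Nk Pk]] := Pinf N.
    by apply: le_trans (HN k Nk Pk); exact: sqr_ge0.
  - exists (b ^+ 2), 0 => d bd; exists 0%N => k _ _; rewrite subr0.
    apply: le_trans (ltW bd); rewrite lerXn2r ?nnegrE//.
    exact: le_trans (sb 0%N).
exists p => u c N uc; rewrite leNgt; apply/negP => cpu.
(* Moving the center to [p - t *: u] changes the limsup by at most [2 t (c - <p, u>) + t^2 |u|^2],
   which minimality makes nonnegative. *)
suff : 0 <= 2 * (c - ip p u) by lra.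
apply: (@ge0_of_small_quadratic _ _ (`|u| ^+ 2)) => t /andP[t0 t1].
rewrite -(lerDl m); apply: (mmin _ (p - t *: u)) => d md.
have [|N' HN'] :=
    Smp (m + (d - (m + (t * (2 * (c - ip p u)) + t ^+ 2 * `|u| ^+ 2)))).
  by rewrite ltrDl subr_gt0.
exists (maxn N N') => k; rewrite geq_max => /andP[k1 k2] Pk.
have := HN' k k2 Pk.
have : t * ip (s k) u <= t * c by rewrite ler_pM2l// uc.
rewrite -!ip_norm !ipE (ipC p (s k)) (ipC u (s k)) (ipC u p); lra.
Qed.

(** * Maximal monotonicity, Minty's theorem and resolvents *)

(** Adjoining [(x, u)] to the graph keeps it monotone, so maximality puts it there already. *)
Lemma maximally_monotone_mem (A : H -> set H) x u :
  maximally_monotone ip A ->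
  (forall a v, A a v -> 0 <= ip (x - a) (u - v)) -> A x u.
Proof.
move=> [Amon Amax] xu; apply: contrapT => nAxu; apply: Amax.
exists (fun a => [set v | A a v \/ (a = x /\ v = u)]); split.
  move=> a a' v v' /= [Aav|[-> ->]] [Aav'|[-> ->]].
  - exact: Amon.
  - by rewrite -opprB -(opprB u) ipNl ipNr opprK; exact: xu.
  - exact: xu.
  - by rewrite !subrr ip_norm sqr_ge0.
split; first by move=> [a v] /=; left.
by move=> /(_ (x, u)) /=; apply: contra_not nAxu; apply; right.
Qed.

(* Minimize the sum of the Fitzpatrick function of [M] and of half the squared
   norms of both variables; [S t] below is a sublevel set of twice this sum. *)
Lemma minty (M : H -> set H) :
  monotone_op ip M ->
  (forall x u, (forall a v, M a v -> 0 <= ip (x - a) (u - v)) -> M x u) ->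
  exists x, M x (- x).
Proof.
move=> Mmon Mmax.
pose S t (p : H * H) := forall a v, M a v ->
  `|p.1 + v| ^+ 2 + `|p.2 + a| ^+ 2 - `|a + v| ^+ 2 <= t.
(* By monotonicity the Fitzpatrick function is at most the pairing on the graph. *)
have SM a v : M a v -> S (`|a + v| ^+ 2) (a, v).
  move=> Mav a' v' /(Mmon _ _ _ _ Mav) /=.
  rewrite -!ip_norm !ipE (ipC v a) (ipC v' a') (ipC v' a) (ipC a' v); lra.
(* By maximality it is at least the pairing everywhere: a graph point violating monotonicity against
   [p] shows it, and without one [p] is itself in the graph. *)
have Slow t (p : H * H) : S t p -> `|p.1 + p.2| ^+ 2 <= t.
  move=> Stp.
  have [[a [v [Mav pav]]]|] :=
      pselect (exists a v, M a v /\ ip (p.1 - a) (p.2 - v) < 0).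
    have := Stp _ _ Mav; move: pav.
    rewrite -!ip_norm !ipE (ipC p.2 p.1) (ipC v p.1) (ipC a p.2) (ipC v a); lra.
  move=> nex; have /Stp : M p.1 p.2.
    apply: Mmax => a v Mav; rewrite leNgt; apply/negP => pav.
    by apply: nex; exists a, v.
  by rewrite (addrC p.2) addrK.
have [m [p [Smp mmin]]] : exists m (p : H * H),
    S m p /\ forall t (q : H * H), S t q -> m <= t.
  apply: (@strongly_convex_min R (H * H)%type S 4^-1 0) => //.
  - exact: cvg_of_sq_dist_pair.
  - by move=> t t' tt' p Stp a v /Stp/le_trans; apply.
  - move=> t t' p q Sp Sq a v Mav; have := Sp _ _ Mav; have := Sq _ _ Mav.
    (* The maximum norm is below the Hilbert norm of the product, so the constant [1/4] survives. *)
    have : `|p - q| ^+ 2 <= `|p.1 - q.1| ^+ 2 + `|p.2 - q.2| ^+ 2.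
      rewrite prod_normE /Num.max; case: ifP => _ /=.
        by rewrite lerDr sqr_ge0.
      by rewrite lerDl sqr_ge0.
    rewrite /= -[`|p.1 + v| ^+ 2]ip_norm -[`|p.2 + a| ^+ 2]ip_norm.
    rewrite -[`|q.1 + v| ^+ 2]ip_norm -[`|q.2 + a| ^+ 2]ip_norm.
    rewrite -[`|p.1 - q.1| ^+ 2]ip_norm -[`|p.2 - q.2| ^+ 2]ip_norm.
    rewrite -[`|_ + _ + v| ^+ 2]ip_norm -[`|_ + _ + a| ^+ 2]ip_norm.
    rewrite !ipE (ipC v) (ipC a) (ipC v) (ipC a) (ipC q.1 p.1) (ipC q.2 p.2).
    lra.
  - move=> t y p yp yS a v Mav; apply/ler_addgt0Pr => e e0.
    apply: (@cvgr_to_le _ \oo _ _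
        (fun n => `|(y n).1 + v| ^+ 2 + `|(y n).2 + a| ^+ 2 - `|a + v| ^+ 2)).
      apply: cvgB; last exact: cvg_cst.
      apply: cvgD; apply: cvg_sqr_norm; apply: cvgD; try exact: cvg_cst.
        by apply: (cvg_comp _ _ yp); exact: cvg_fst.
      by apply: (cvg_comp _ _ yp); exact: cvg_snd.
    near=> n; apply: le_trans (yS n _ _ Mav) _; rewrite lerD2l ltW//.
    by near: n; exact: harmonic_lt_near.
  - by move=> t p /Slow; apply: le_trans; exact: sqr_ge0.
  - have [[a [v Mav]]|nex] := pselect (exists a v, M a v).
      by eexists; eexists; exact: SM Mav.
    exists 0, 0 => a v Mav; exfalso; apply: nex; by exists a, v.
(* Strong convexity: a graph point exceeds the minimum by at least its squared distance to [p].
   Perturb [p] towards [(a, v)] and let [t] tend to 0. *)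
have key a v : M a v ->
    m + `|p.1 - a| ^+ 2 + `|p.2 - v| ^+ 2 <= `|a + v| ^+ 2.
  move=> Mav; rewrite -subr_ge0.
  pose K := `|p.1 - a| ^+ 2 + `|p.2 - v| ^+ 2.
  apply: (@ge0_of_small_quadratic _ _ K) => t /andP[t0 t1].
  suff : m <= (1 - t) * m + t * `|a + v| ^+ 2 - t * (1 - t) * K.
    by rewrite /K; lra.
  apply: (mmin _ (p.1 + t *: (a - p.1), p.2 + t *: (v - p.2))) => a' v' Mav'.
  have : (1 - t) * (`|p.1 + v'| ^+ 2 + `|p.2 + a'| ^+ 2 - `|a' + v'| ^+ 2)
      <= (1 - t) * m by rewrite ler_wpM2l ?subr_ge0// Smp.
  have : t * (`|a + v'| ^+ 2 + `|v + a'| ^+ 2 - `|a' + v'| ^+ 2)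
      <= t * `|a + v| ^+ 2 by rewrite ler_wpM2l ?(ltW t0)//; exact: SM Mav _ _ Mav'.
  rewrite /K /= (addrAC p.1) (addrAC p.2).
  have -> : a - p.1 = (a + v') - (p.1 + v') by rewrite opprD addrACA subrr addr0.
  have -> : v - p.2 = (v + a') - (p.2 + a') by rewrite opprD addrACA subrr addr0.
  rewrite !sq_norm_segment.
  have -> : p.1 + v' - (a + v') = p.1 - a by rewrite opprD addrACA subrr addr0.
  have -> : p.2 + a' - (v + a') = p.2 - v by rewrite opprD addrACA subrr addr0.
  lra.
have mlow := Slow _ _ Smp.
(* [key] and [|p.1 + p.2|^2 <= m] give [<p.2 + a, p.1 + v> >= |p.1 + p.2|^2]. *)
have Mp : M (- p.2) (- p.1).
  apply: Mmax => a v /key; move: mlow.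
  have := sqr_ge0 `|p.1 + p.2|.
  rewrite -!ip_norm !ipE (ipC p.2 p.1) (ipC v a) (ipC v p.2) (ipC a p.1); lra.
(* At this graph point [key] forces [2 |p.1 + p.2|^2 <= 0]. *)
have := key _ _ Mp; move: mlow.
have -> : - p.2 - p.1 = - (p.1 + p.2) by rewrite opprD addrC.
rewrite !opprK (addrC p.2) normrN => mlow pp.
have : `|p.1 + p.2| ^+ 2 <= 0 by lra.
rewrite le_eqVlt ltNge sqr_ge0 orbF sqrf_eq0 normr_eq0 addr_eq0 => /eqP p12.
by exists (- p.2); move: Mp; rewrite p12.
Unshelve. all: by end_near. Qed.

(** Minty's theorem for [g A - x] yields [y] with [x - y] in [g A y], so the set defining the
    resolvent is inhabited and the default of [xget] is avoided. *)
Lemma resolventP (A : H -> set H) g x :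
  maximally_monotone ip A -> 0 < g ->
  A (resolvent (op_scale g A) x) (g^-1 *: (x - resolvent (op_scale g A) x)).
Proof.
move=> Amax g0; have g_neq0 : g != 0 by rewrite gt_eqF.
have [y Ay] : exists y, A y (g^-1 *: (- y + x)).
  apply: (@minty (fun y => [set u | A y (g^-1 *: (u + x))])).
    move=> y y' u u' /= Ayu Ayu'.
    have := Amax.1 _ _ _ _ Ayu Ayu'.
    rewrite -scalerBr ipZr pmulr_rge0 ?invr_gt0//.
    by rewrite opprD addrACA subrr addr0.
  move=> y u yu; apply: (maximally_monotone_mem Amax) => a v Aav.
  have := yu a (g *: v - x).
  rewrite /= subrK scalerA mulVf// scale1r => /(_ Aav).
  have -> : u - (g *: v - x) = g *: (g^-1 *: (u + x) - v).
    by rewrite scalerBr scalerA mulfV// scale1r opprB addrCA addrA [u + x]addrC.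
  by rewrite ipZr pmulr_rge0.
set r := resolvent _ _.
have [_ -> [_ [v Av <-]] <-] :
    op_inv (op_add (op_of idfun) (op_scale g A)) x r.
  apply: xgetPex; exists y; exists y => //.
  exists (g *: (g^-1 *: (- y + x))); first by exists (g^-1 *: (- y + x)).
  by rewrite scalerA mulfV// scale1r addrA subrr add0r.
by rewrite addrAC subrr add0r scalerA mulVf// scale1r.
Qed.

(** * Primal and dual solutions, and the forward-backward step *)

Section PrimalDual.
Context (A : H -> set H) (B : H -> H) (alpha : R).
Context (alpha_gt0 : 0 < alpha) (A_max : maximally_monotone ip A).
Context (B_coco : cocoercive ip alpha B).

Lemma primal_solE p : primal_sol A B p <-> A p (- B p).
Proof.
split=> [[u Apu [_ -> /eqP]]|ApB].
  by rewrite addr_eq0 => /eqP <-.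
by exists (- B p) => //; exists (B p); rewrite ?addNr.
Qed.

(** The two summands of the dual inclusion cancel, so a single [p] satisfies both [A p (- y)] and
    [B p = y]. *)
Lemma dual_sol_image : dual_sol A B = B @` primal_sol A B.
Proof.
apply/seteqP; split=> [y [_ [p Ap <-] [q yq /eqP]]|_ [p /primal_solE Ap <-]].
  rewrite addrC subr_eq0 => /eqP qp; exists q => //.
  by apply/primal_solE; move: Ap; rewrite /op_inv /= yq qp.
exists (- p); first by exists p.
by exists p => //; rewrite addNr.
Qed.

(** Monotonicity of [A] makes [<p - q, B p - B q>] nonpositive, while cocoercivity bounds it below.
    This yields uniqueness of the dual solution. *)
Lemma cocoercive_constant_on_primal_sol p q :
  primal_sol A B p -> primal_sol A B q -> B p = B q.
Proof.
move=> /primal_solE Ap /primal_solE Aq.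
have : 0 <= ip (p - q) (- B p - - B q) := A_max.1 _ _ _ _ Ap Aq.
rewrite -opprD ipNr => pq; have := B_coco p q => pq'.
have : alpha * `|B p - B q| ^+ 2 <= 0 by lra.
rewrite pmulr_rle0// le_eqVlt ltNge sqr_ge0 orbF sqrf_eq0 normr_eq0 subr_eq0.
by move/eqP.
Qed.

Lemma cocoercive_lipschitz p q : alpha * `|B p - B q| <= `|p - q|.
Proof.
have [->|Bpq] := eqVneq (B p) (B q); first by rewrite subrr normr0 mulr0.
have : 0 < `|B p - B q| by rewrite normr_gt0 subr_eq0.
move=> /ler_pM2r <-; rewrite -mulrA -expr2.
exact: le_trans (B_coco p q) (ip_le_norm _ _).
Qed.

Lemma cocoercive_monotone p q : 0 <= ip (p - q) (B p - B q).
Proof. by apply: le_trans (B_coco p q); rewrite mulr_ge0 ?sqr_ge0// ltW. Qed.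

(* A step of the forward-backward map with stepsize below [alpha] exhibits the
   graph point at which the variational inequality is tested. *)
Lemma primal_sol_variational p :
  primal_sol A B p <-> forall a v, A a v -> ip p (v + B a) <= ip a (v + B a).
Proof.
split=> [/primal_solE Ap a v Aav|pvar].
  have := A_max.1 _ _ _ _ Aav Ap; have := cocoercive_monotone a p.
  rewrite !ipE; lra.
(* As [B] is [1/alpha]-Lipschitz, this stepsize keeps the cross term below [|a - p|^2 / 2], which
   forces [a = p]. *)
pose g := alpha / 2; have g0 : 0 < g by rewrite divr_gt0.
pose a := resolvent (op_scale g A) (p - g *: B p).
have Aa : A a (g^-1 *: (p - g *: B p - a)) by exact: resolventP.
have : 0 <= g * ip (a - p) (g^-1 *: (p - g *: B p - a) + B a).
  by rewrite mulr_ge0 ?(ltW g0)// ipDl ipNl subr_ge0; exact: pvar.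
rewrite -ipZr scalerDr scalerA mulfV ?gt_eqF// scale1r.
have -> : p - g *: B p - a + g *: B a = - (a - p) + g *: (B a - B p).
  rewrite scalerBr opprB [p - g *: B p - a]addrAC -[LHS]addrA.
  by rewrite [- (g *: B p) + _]addrC.
rewrite ipDr ipNr ipZr ip_norm => h.
have ap : g * ip (a - p) (B a - B p) <= 2^-1 * `|a - p| ^+ 2.
  have := ler_wpM2l (normr_ge0 (a - p)) (cocoercive_lipschitz a p).
  rewrite mulrCA -expr2 => h1.
  have := ler_wpM2l (ltW alpha_gt0) (ip_le_norm (a - p) (B a - B p)).
  rewrite /g; lra.
have : `|a - p| ^+ 2 <= 0 by lra.
rewrite le_eqVlt ltNge sqr_ge0 orbF sqrf_eq0 normr_eq0 subr_eq0 => /eqP eap.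
apply/primal_solE; move: Aa; rewrite eap addrAC subrr add0r scalerN scalerA.
by rewrite mulVf ?gt_eqF// scale1r.
Qed.

Lemma primal_sol_bigcap : primal_sol A B =
  \bigcap_(av in op_graph A)
    [set p | ip p (av.2 + B av.1) <= ip av.1 (av.2 + B av.1)].
Proof.
apply/seteqP; split=> [p /primal_sol_variational pv [a v] /pv//|p pv].
by apply/primal_sol_variational => a v Aav; exact: (pv (a, v)).
Qed.

Lemma closed_primal_sol : closed (primal_sol A B).
Proof.
by rewrite primal_sol_bigcap; apply: closed_bigI => av _; exact: closed_ip_le.
Qed.

Lemma primal_sol_segment_closed : segment_closed (primal_sol A B).
Proof.
move=> p q t /primal_sol_variational pv /primal_sol_variational qv /andP[t0 t1].
apply/primal_sol_variational => a v Aav.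
have -> : p + t *: (q - p) = (1 - t) *: p + t *: q.
  by rewrite scalerBl scale1r scalerBr addrA addrAC.
rewrite ipDl !ipZl.
have := ler_wpM2l t0 (qv _ _ Aav).
have : (1 - t) * ip p (v + B a) <= (1 - t) * ip a (v + B a).
  by rewrite ler_wpM2l ?subr_ge0// pv.
lra.
Qed.

(** Monotonicity of [A], cocoercivity and Young's inequality give [<p - w, x - w> <= g / (4 alpha)
    |x - w|^2]; the upper bound on [m] says precisely that [g / (4 alpha) <= 1 - m]. *)
Lemma forward_backward_cut p x w g m : 0 < g -> 0 <= m ->
  m <= (4 * alpha - g) / (4 * alpha) ->
  A w (g^-1 *: (x - g *: B x - w)) -> primal_sol A B p ->
  halfspace ip x (x + m *: (w - x)) p.
Proof.
move=> g0 m0 mle Aw /primal_solE Ap; rewrite /halfspace /=.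
have h1 : 0 <= ip (w - p) (x - g *: B x - w + g *: B p).
  have := A_max.1 _ _ _ _ Aw Ap.
  rewrite opprK => /(mulr_ge0 (ltW g0)); rewrite -ipZr scalerDr scalerA.
  by rewrite mulfV ?gt_eqF// scale1r.
have h2 := B_coco x p.
(* Young: [- g <w - x, B x - B p> <=
   g / (4 alpha) |w - x|^2 + g alpha |B x - B p|^2] *)
have h3 : 0 <= g / (4 * alpha) * `|(w - x) + (2 * alpha) *: (B x - B p)| ^+ 2.
  by rewrite mulr_ge0 ?sqr_ge0// divr_ge0 ?ltW// mulr_gt0.
have h4 := ler_wpM2l (ltW g0) h2.
have -> : x + m *: (w - x) = x - m *: (x - w) by rewrite -scalerN opprB.
have -> : ip (p - (x - m *: (x - w))) (x - (x - m *: (x - w))) =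
  m * (ip (p - w) (x - w) - (1 - m) * `|x - w| ^+ 2).
  rewrite -ip_norm !ipE (ipC p x) (ipC w x); ring.
rewrite mulr_ge0_le0//.
have h5 : g / (4 * alpha) <= 1 - m.
  by move: mle; rewrite mulrBl mulfV ?mulf_neq0 ?gt_eqF//; lra.
have := ler_wpM2r (sqr_ge0 `|x - w|) h5.
suff : ip (p - w) (x - w) <= g / (4 * alpha) * `|x - w| ^+ 2 by lra.
have e1 : g / (4 * alpha) * `|(w - x) + (2 * alpha) *: (B x - B p)| ^+ 2 =
    g / (4 * alpha) * `|x - w| ^+ 2 + g * ip (w - x) (B x - B p)
    + g * (alpha * `|B x - B p| ^+ 2).
  rewrite -!ip_norm !ipE (ipC x w) (ipC (B p) (B x)).
  rewrite (ipC (B x) w) (ipC (B x) x) (ipC (B p) w) (ipC (B p) x); field.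
  by rewrite gt_eqF.
move: h1 h3 h4; rewrite e1 !ipE (ipC p x) (ipC w x) (ipC p w); lra.
Qed.

(** Makes the variational inequality hold in the limit once [x - w] vanishes. Here [r] lies in
    [A w + B w], so monotonicity of the sum replaces [v + B a] by [r], which is of the order of
    [|x - w|]. *)
Lemma forward_backward_bound x w g a v : 0 < g ->
  A w (g^-1 *: (x - g *: B x - w)) -> A a v ->
  ip (x - a) (v + B a) <=
    `|w - a| * ((g^-1 + alpha^-1) * `|x - w|) + `|x - w| * `|v + B a|.
Proof.
move=> g0 Aw Aav.
pose r := g^-1 *: (x - w) + (B w - B x).
have h1 := A_max.1 _ _ _ _ Aw Aav.
have h2 := cocoercive_monotone w a.
have h3 : ip (w - a) (v + B a) <= ip (w - a) r.
  move: h1 h2; rewrite addrAC [g^-1 *: _]scalerBr scalerA mulVf ?gt_eqF// scale1r.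
  by rewrite /r !(ipDr (w - a)) !(ipNr (w - a)); lra.
have h4 : `|r| <= (g^-1 + alpha^-1) * `|x - w|.
  apply: (le_trans (ler_normD _ _)); rewrite mulrDl lerD//.
    by rewrite normrZ gtr0_norm// invr_gt0.
  by rewrite ler_pdivlMl// [`|x - w|]distrC cocoercive_lipschitz.
have h5 := ler_wpM2l (normr_ge0 (w - a)) h4.
have h6 := ip_le_norm (w - a) r.
have h7 := ip_le_norm (x - w) (v + B a).
have -> : x - a = (w - a) + (x - w) by rewrite [RHS]addrC addrA subrK.
rewrite ipDl; lra.
Qed.

End PrimalDual.

(** * Haugazeau's scheme for an abstract target set *)

Lemma haugazeauP x y z : let q := haugazeau ip x y z in
  (halfspace ip x y `&` halfspace ip y z) !=set0 ->
  [/\ halfspace ip x y q, halfspace ip y z q &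
    forall p, halfspace ip x y p -> halfspace ip y z p -> halfspace ip x q p].
Proof.
move=> q; rewrite /q /haugazeau; set D := _ `&` _ => Dne.
have [| |[Hxy Hyz] qmin] := @metric_projP D x Dne.
- by apply: closedI; exact: closed_halfspace.
- move=> p p' t [? ?] [? ?] t01.
  by split; exact: halfspace_segment_closed.
by split=> // p ? ?; exact: qmin.
Qed.

Section Haugazeau.
Context (Z : set H) (x0 : H) (x z : nat -> H).
Context (Z_ne : Z !=set0) (Z_cut : forall n, Z `<=` halfspace ip (x n) (z n)).
Context (x_init : x 0%N = x0)
  (x_step : forall n, x n.+1 = haugazeau ip x0 (x n) (z n)).

(** Induction: [Z] inside both half-spaces keeps their intersection nonempty, and the variational
    inequality of the projection is the next cut. The first half-space is the whole space. *)
Lemma haugazeau_cut n : Z `<=` halfspace ip x0 (x n).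
Proof.
elim: n => [p _|n IHn p Zp].
  by rewrite /halfspace /= x_init subrr linear0r.
have [|_ _ qmin] := @haugazeauP x0 (x n) (z n).
  by exists p; split; [exact: IHn | exact: Z_cut].
by rewrite x_step; apply: qmin; [exact: IHn | exact: Z_cut].
Qed.

Lemma haugazeau_step n :
  halfspace ip x0 (x n) (x n.+1) /\ halfspace ip (x n) (z n) (x n.+1).
Proof.
have [p Zp] := Z_ne.
have [|? ? _] := @haugazeauP x0 (x n) (z n).
  by exists p; split; [exact: haugazeau_cut | exact: Z_cut].
by rewrite x_step.
Qed.

Lemma haugazeau_dist_le p n : Z p -> `|x n - x0| <= `|p - x0|.
Proof.
move=> /(@haugazeau_cut n); rewrite /halfspace /= => pcut.
rewrite -(@ler_pXn2r _ 2)// ?nnegrE//.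
have := sqr_ge0 `|p - x n|.
move: pcut; rewrite -!ip_norm !ipE (ipC x0 p) (ipC (x n) p) (ipC x0 (x n)).
lra.
Qed.

Lemma haugazeau_bounded : exists b, forall n, `|x n| <= b.
Proof.
have [p Zp] := Z_ne; exists (`|p - x0| + `|x0|) => n.
rewrite -{1}(subrK x0 (x n)) (le_trans (ler_normD _ _))// lerD2r.
exact: haugazeau_dist_le.
Qed.

(** The two half-spaces give [|x n.+1 - x n|^2 <= e n.+1 - e n] and [|z n - x n| <= |x n.+1 - x n|];
    the bounded monotone [e] has vanishing increments. *)
Lemma haugazeau_residual : `|z n - x n| @[n --> \oo] --> 0.
Proof.
pose e n := `|x n - x0| ^+ 2.
have step n : `|z n - x n| ^+ 2 <= e n.+1 - e n.
  have [] := haugazeau_step n; rewrite /halfspace /= /e => h1 h2.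
  have := sqr_ge0 `|x n.+1 - z n|; move: h1 h2.
  rewrite -!ip_norm !ipE (ipC (z n) (x n)) (ipC x0 (x n)) (ipC x0 (x n.+1)).
  rewrite (ipC (z n) (x n.+1)); lra.
have ecvg : cvgn e.
  apply: nondecreasing_is_cvgn.
    apply/nondecreasing_seqP => n; rewrite -subr_ge0.
    by apply: le_trans (step n); exact: sqr_ge0.
  have [p Zp] := Z_ne; exists (`|p - x0| ^+ 2) => _ [n _ <-].
  by rewrite lerXn2r ?nnegrE// haugazeau_dist_le.
have de : (fun n => e n.+1 - e n) @ \oo --> 0.
  by rewrite -(subrr (limn e)); apply: (cvgB _ ecvg);
    rewrite (cvg_shiftS e).
apply/cvgrPdist_lt => d d0.
near=> n; rewrite sub0r normrN normr_id.
rewrite -(@ltr_pXn2r _ 2)// ?nnegrE ?(ltW d0)//.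
apply: le_lt_trans (step n) _.
by near: n; apply: (cvgr_lt _ de); rewrite exprn_gt0.
Unshelve. all: by end_near. Qed.

(** Otherwise infinitely many iterates, selected by [P], stay [e] away from [p]. The distance bound
    then gives [<x k - p, p - x0> <= - e^2 / 2], which passes to a weak cluster point in [Z] and
    contradicts the projection inequality. *)
Lemma haugazeau_cvg : closed Z -> segment_closed Z ->
  (forall (P : nat -> Prop) y, (forall u c N,
    (forall k, (N <= k)%N -> P k -> ip (x k) u <= c) -> ip y u <= c) -> Z y) ->
  x @ \oo --> metric_proj Z x0.
Proof.
move=> Zcl Zseg Zcluster.
have [Zp pmin] := @metric_projP Z x0 Z_ne Zcl Zseg.
set p := metric_proj Z x0 in Zp pmin *.
have [b xb] := haugazeau_bounded.
apply/cvgrPdist_lt => e e0; apply: contrapT => nfar.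
pose P k := e <= `|p - x k|.
have [N|y ycl] := @weak_cluster_point x P b xb.
  apply: contrapT => nP; apply: nfar; exists N => // k Nk /=.
  by rewrite ltNge; apply/negP => Pk; apply: nP; exists k.
have := pmin y (Zcluster P y ycl).
have : ip y (p - x0) <= ip p (p - x0) - e ^+ 2 / 2.
  apply: (ycl _ _ 0%N) => k _ Pk.
  have : e ^+ 2 <= `|p - x k| ^+ 2 by rewrite lerXn2r ?nnegrE ?(ltW e0).
  have : `|x k - x0| ^+ 2 <= `|p - x0| ^+ 2.
    by rewrite lerXn2r ?nnegrE// haugazeau_dist_le.
  rewrite -!ip_norm !ipE (ipC x0 p) (ipC x0 (x k)) (ipC (x k) p); lra.
have : 0 < e ^+ 2 by rewrite exprn_gt0.
rewrite !ipE; lra.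
Qed.

End Haugazeau.

End HilbertSpace.

(** * Convergence of the primal and dual iterates *)

Unset Implicit Arguments.

Theorem theorem8p9 (R : realType) (H : completeNormedModType R)
    (ip : {dot H for idfun})
    (ip_norm : forall x : H, ip x x = `|x| ^+ 2)
    (alpha : R) (alpha_gt0 : 0 < alpha)
    (A : H -> set H) (A_max : maximally_monotone ip A)
    (B : H -> H) (B_coco : cocoercive ip alpha B)
    (eps : R) (eps_bounds : 0 < eps < Num.min (1 / 2) (2 * alpha))
    (gamma : nat -> R)
    (gamma_bounds : forall n, eps <= gamma n <= 2 * alpha)
    (mu : nat -> R)
    (mu_bounds : forall n,
       eps <= mu n <= (4 * alpha - gamma n) / (4 * alpha))
    (Z_nonempty : primal_sol A B !=set0)
    (x0 : H) (x b w : nat -> H)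
    (x_init : x 0%N = x0)
    (b_def : forall n, b n = gamma n *: B (x n))
    (w_def : forall n,
       w n = resolvent (op_scale (gamma n) A) (x n - b n))
    (x_step : forall n,
       x n.+1 = haugazeau ip x0 (x n) (x n + mu n *: (w n - x n))) :
  (x @ \oo --> metric_proj (primal_sol A B) x0) /\
  (exists xbar : H,
     dual_sol A B = [set xbar] /\ (fun n => B (x n)) @ \oo --> xbar).
Proof.
have /andP[eps0 _] := eps_bounds.
have gamma_ge n : eps <= gamma n by have /andP[] := gamma_bounds n.
have gamma_gt0 n : 0 < gamma n by exact: lt_le_trans (gamma_ge n).
have mu_ge n : eps <= mu n by have /andP[] := mu_bounds n.
have Aw n : A (w n) ((gamma n)^-1 *: (x n - gamma n *: B (x n) - w n)).
  by rewrite w_def -b_def; exact: resolventP.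
pose z n := x n + mu n *: (w n - x n).
have Zcut n : primal_sol A B `<=` halfspace ip (x n) (z n).
  move=> p Zp; have /andP[m0 m1] := mu_bounds n.
  apply: (forward_backward_cut ip_norm alpha_gt0 A_max B_coco _ _ m1 (Aw n) Zp) => //.
  exact: le_trans (ltW eps0) m0.
have Zcl := closed_primal_sol ip_norm alpha_gt0 A_max B_coco.
have Zseg := primal_sol_segment_closed ip_norm alpha_gt0 A_max B_coco.
have [c xc] := haugazeau_bounded ip_norm Z_nonempty Zcut x_init x_step.
have d0 : `|x n - w n| @[n --> \oo] --> 0.
  have zx0 := haugazeau_residual ip_norm Z_nonempty Zcut x_init x_step.
  (* [z n - x n] is [mu n] times [w n - x n], and [mu n >= eps]. *)
  apply: (@squeeze_cvgr _ _ _ _ (fun=> 0) (fun n => eps^-1 * `|z n - x n|)).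
  - near=> n; rewrite normr_ge0 /= ler_pdivlMl// /z addrAC subrr add0r normrZ.
    rewrite (distrC (w n)) ler_wpM2r// (le_trans (mu_ge n))//.
    exact: ler_norm.
  - exact: cvg_cst.
  - by rewrite -(mulr0 eps^-1); exact: cvgMr.
have xcvg : x @ \oo --> metric_proj (primal_sol A B) x0.
  apply: (haugazeau_cvg ip_norm Z_nonempty Zcut x_init x_step) => // P y ycl.
  apply/(primal_sol_variational ip_norm alpha_gt0 A_max B_coco) => a v Aav.
  set v' := v + B a.
  (* Majorant from [forward_backward_bound], using [|x n| <= c] and [(gamma n)^-1 <= eps^-1]. *)
  pose f n := (`|x n - w n| + (c + `|a|)) *
    ((eps^-1 + alpha^-1) * `|x n - w n|) + `|x n - w n| * `|v'|.
  have f0 : f @ \oo --> 0.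
    rewrite (_ : 0 = (0 + (c + `|a|)) * ((eps^-1 + alpha^-1) * 0) + 0 * `|v'|).
      apply: cvgD; last by apply: cvgM => //; exact: cvg_cst.
      apply: cvgM; first by apply: cvgD => //; exact: cvg_cst.
      exact: cvgMr.
    by rewrite mulr0 mulr0 mul0r addr0.
  apply/ler_addgt0Pr => e e0.
  have [N _ fN] : \forall n \near \oo, f n < e by exact: (cvgr_lt _ f0).
  apply: (ycl _ _ N) => k Nk _; rewrite -lerBlDl -ipNl -ipDl.
  apply: le_trans (ltW (fN k Nk)).
  apply: le_trans
    (forward_backward_bound ip_norm alpha_gt0 A_max B_coco _ (Aw k) Aav) _ => //.
  rewrite lerD2r ler_pM ?mulr_ge0 ?addr_ge0 ?invr_ge0
    ?(ltW (gamma_gt0 k)) ?(ltW alpha_gt0)//.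
    have -> : w k - a = (w k - x k) + (x k - a) by rewrite addrA subrK.
    rewrite (le_trans (ler_normD _ _))// distrC lerD2l.
    by rewrite (le_trans (ler_normB _ _))// lerD2r.
  by rewrite ler_wpM2r// lerD2r lef_pV2 ?posrE.
split=> //; set p := metric_proj _ _ in xcvg.
have [Zp _] := metric_projP ip_norm x0 Z_nonempty Zcl Zseg.
(* Dual solutions are the values of [B] on primal ones, where [B] is constant; the projection is one
   of these. *)
exists (B p); split.
  rewrite dual_sol_image; apply/seteqP; split=> [_ [q Zq <-]|_ ->].
    exact: (cocoercive_constant_on_primal_sol alpha_gt0 A_max B_coco).
  by exists p.
apply/cvgrPdist_lt => e e0; near=> n.
rewrite -(ltr_pM2l alpha_gt0).
apply: le_lt_trans (cocoercive_lipschitz ip_norm B_coco _ _) _.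
by near: n; move/cvgrPdist_lt: xcvg; apply; rewrite mulr_gt0.
Unshelve. all: by end_near. Qed.
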